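(* Let $X$ be a Banach space. If $X$ has the graphon representation property, then $X$ is weakly sequentially complete.
   Context: All Banach spaces are real; $[0,1]^S$ ($S$ a finite set) carries Lebesgue measure; $\langle\phi,x\rangle:=\phi(x)$ for $\phi\in X^*$, $x\in X$. An $X$-decorated target graph is a pair $\mathbf G=(G,g)$ where $G$ is a finite graph that is complete and completely looped (every two vertices are adjacent and every vertex has a loop) and $g:E(G)\to X$. An $X^*$-decorated test graph is a pair $\mathbf F=(F,f)$ where $F$ is a finite simple graph (without loops) and $f:E(F)\to X^*$. The homomorphism density is $$t(\mathbf F,\mathbf G)=\frac{1}{|V(G)|^{|V(F)|}}\sum_{\varphi:V(F)\to V(G)}\ \prod_{ij\in E(F)}\langle f(ij),g(\varphi(i)\varphi(j))\rangle,$$ the sum being over all maps $\varphi$. For $1\le p<\infty$ put $\|\mathbf G\|_p=\big(|V(G)|^{-2}\sum_{u,v\in V(G)}\|g(uv)\|_X^p\big)^{1/p}$. An $X$-valued Bochner graphon is a Bochner (strongly) measurable function $W:[0,1]^2\to X$ which is symmetric ($W(x,y)=W(y,x)$ for a.e. $(x,y)$) and satisfies $\|W(\cdot,\cdot)\|_X\in L^p([0,1]^2)$ for every $1\le p<\infty$. Its densities are $$t(\mathbf F,W)=\int_{[0,1]^{V(F)}}\prod_{ij\in E(F)}\langle f(ij),W(x_i,x_j)\rangle\prod_{i\in V(F)}dx_i.$$ $X$ has the graphon representation property if: whenever a sequence $(\mathbf G_n)$ of $X$-decorated target graphs satisfies (1) $\sup_n\|\mathbf G_n\|_p<\infty$ for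 every $1\le p<\infty$ and (2) $(t(\mathbf F,\mathbf G_n))_n$ converges for every $X^*$-decorated test graph $\mathbf F$, there is an $X$-valued Bochner graphon $W$ with $t(\mathbf F,\mathbf G_n)\to t(\mathbf F,W)$ for every $X^*$-decorated test graph $\mathbf F$. (The numbers of vertices $|V(G_n)|$ are not required to tend to infinity.) $X$ is weakly sequentially complete if every sequence $(x_n)$ in $X$ such that $(\varphi(x_n))$ is Cauchy for every $\varphi\in X^*$ converges weakly to an element of $X$. *)

(* Defs.v *)
From HB Require Import structures.
From mathcomp Require Import all_boot all_order all_algebra.
From mathcomp Require Import all_classical all_reals all_analysis.

Set Implicit Arguments.
Unset Strict Implicit.
Unset Printing Implicit Defensive.

Import Order.TTheory GRing.Theory Num.Theory.
Import numFieldNormedType.Exports.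

Local Open Scope classical_set_scope.
Local Open Scope ring_scope.

(** ** Topological dual and weak sequential completeness *)

Record dual (R : realType) (X : normedModType R) := Dual {
  dual_fun :> {linear X -> R^o};
  dual_continuous : continuous dual_fun }.

Definition weakly_cauchy (R : realType) (X : normedModType R)
    (x : nat -> X) : Prop :=
  forall phi : dual X, cauchy (phi (x n) @[n --> \oo]).

Definition weakly_cvg_to (R : realType) (X : normedModType R)
    (x : nat -> X) (a : X) : Prop :=
  forall phi : dual X, phi (x n) @[n --> \oo] --> phi a.

Definition weakly_sequentially_complete (R : realType)
    (X : normedModType R) : Prop :=
  forall x : nat -> X, weakly_cauchy x -> exists a : X, weakly_cvg_to x a.

(** ** Decorated graphs *)

(* Every pair of vertices (equal or not) is an edge, so the edge set need not
   be stored: a decoration is a symmetric function of two vertices. *)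
Record target_graph (X : Type) := TargetGraph {
  tg_vertex :> finType;
  tg_nonempty : (0 < #|tg_vertex|)%N;
  tg_dec : tg_vertex -> tg_vertex -> X;
  tg_dec_sym : forall u v, tg_dec u v = tg_dec v u }.

(* The values of [sg_dec] at non-adjacent pairs are never used. *)
Record test_graph (Y : Type) := TestGraph {
  sg_vertex :> finType;
  sg_adj : rel sg_vertex;
  sg_adj_sym : symmetric sg_adj;
  sg_adj_irr : irreflexive sg_adj;
  sg_dec : sg_vertex -> sg_vertex -> Y;
  sg_dec_sym : forall i j, sg_adj i j -> sg_dec i j = sg_dec j i }.

(* Each undirected edge is listed exactly once, by the one of its two
   orientations that is increasing for the enumeration of the vertices. *)
Definition edges (Y : Type) (F : test_graph Y) : {set F * F} :=
  [set e : F * F | sg_adj e.1 e.2 && (enum_rank e.1 < enum_rank e.2)%N]%SET.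

Section Densities.
Context (R : realType) (X : normedModType R).

Definition hom_density (F : test_graph (dual X)) (G : target_graph X) : R :=
  (#|G|%:R ^+ #|F|)^-1 *
  \sum_(h : {ffun F -> G})
    \prod_(e in edges F) sg_dec e.1 e.2 (tg_dec (h e.1) (h e.2)).

Definition graph_pnorm (p : R) (G : target_graph X) : R :=
  ((#|G|%:R ^+ 2)^-1 * \sum_(u : G) \sum_(v : G) `|tg_dec u v| `^ p) `^ p^-1.

End Densities.

(** ** Lebesgue measure on the unit cubes *)

Section UnitInterval.
Context (R : realType).

(* Lebesgue measure on [[0, 1]], as a probability measure on the line; all the
   integrals and "almost everywhere" below thus ignore what happens outside. *)
Definition unit_lebesgue : set (measurableTypeR R) -> \bar R :=
  mrestr (@lebesgue_measure R)
    (measurable_itv `[0, 1] : measurable (`[0, 1] : set (measurableTypeR R))).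

HB.instance Definition _ := Measure.on unit_lebesgue.

Let unit_lebesgue_setT : unit_lebesgue setT = 1%E.
Proof.
by rewrite /unit_lebesgue /mrestr setTI lebesgue_measure_itv /= lte01 oppr0 adde0.
Qed.

HB.instance Definition _ :=
  Measure_isProbability.Build _ _ _ unit_lebesgue unit_lebesgue_setT.

End UnitInterval.

Section ConsMeasure.
Context d (T : measurableType d) (R : realType) (n : nat).
Context (P : probability T R) (Q : probability (n.-tuple T) R).

Let cons_pair (z : T * n.-tuple T) : n.+1.-tuple T := [tuple of z.1 :: z.2].

Let measurable_cons_pair : measurable_fun setT cons_pair.
Proof. exact: measurable_cons. Qed.

Definition cons_measure : set (n.+1.-tuple T) -> \bar R :=
  pushforward (P \x Q)%E (fun z => [tuple of z.1 :: z.2]).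

Let cons_measure0 : cons_measure set0 = 0%E.
Proof. by rewrite /cons_measure /pushforward preimage_set0 measure0. Qed.

Let cons_measure_ge0 A : (0 <= cons_measure A)%E.
Proof. exact: measure_ge0. Qed.

Let cons_measure_sigma_additive : semi_sigma_additive cons_measure.
Proof.
move=> F mF tF mUF; rewrite /cons_measure /pushforward preimage_bigcup.
apply: measure_semi_sigma_additive.
- by move=> k; rewrite -[X in measurable X]setTI; exact: measurable_cons_pair.
- apply/trivIsetP => /= i j _ _ ij; rewrite -preimage_setI.
  by move/trivIsetP : tF => /(_ _ _ _ _ ij) -> //; rewrite preimage_set0.
- rewrite -preimage_bigcup -[X in measurable X]setTI.
  exact: measurable_cons_pair.
Qed.

HB.instance Definition _ := isMeasure.Build _ _ _ cons_measure
  cons_measure0 cons_measure_ge0 cons_measure_sigma_additive.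

Let cons_measure_setT : cons_measure setT = 1%E.
Proof.
rewrite /cons_measure /pushforward preimage_setT -setXTT product_measure1E //.
rewrite -[RHS]mule1; congr (_ * _)%E; exact: probability_setT.
Qed.

HB.instance Definition _ :=
  Measure_isProbability.Build _ _ _ cons_measure cons_measure_setT.

End ConsMeasure.

Fixpoint power_measure d (T : measurableType d) (R : realType)
    (P : probability T R) (n : nat) : probability (n.-tuple T) R :=
  match n with
  | 0 => \d_([tuple] : 0.-tuple T)
  | m.+1 => cons_measure P (power_measure P m)
  end.

Definition unit_square (R : realType) :
    {measure set (measurableTypeR R * measurableTypeR R) -> \bar R} :=
  (@unit_lebesgue R \x @unit_lebesgue R)%E.

Definition unit_cube (R : realType) (n : nat) :
    probability (n.-tuple (measurableTypeR R)) R :=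
  power_measure (@unit_lebesgue R) n.

(** ** Bochner graphons *)

Definition simple_fun d (T : measurableType d) (X : Type) (s : T -> X) : Prop :=
  finite_set (range s) /\ forall a : X, measurable (s @^-1` [set a]).

Definition bochner_measurable d (T : measurableType d) (R : realType)
    (mu : {measure set T -> \bar R}) (X : normedModType R) (f : T -> X) : Prop :=
  exists s : nat -> T -> X, (forall n, simple_fun (s n)) /\
    {ae mu, forall z, s n z @[n --> \oo] --> f z}.

Record bochner_graphon (R : realType) (X : normedModType R) := BochnerGraphon {
  bg_fun :> measurableTypeR R * measurableTypeR R -> X;
  bg_measurable : bochner_measurable (unit_square R) bg_fun;
  bg_sym : {ae unit_square R, forall z, bg_fun z = bg_fun (z.2, z.1)};
  bg_Lp : forall p : R, 1 <= p ->
    finite_norm (unit_square R) p%:E (fun z => `|bg_fun z|) }.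

(* A point of the cube indexed by [V(F)] is a tuple [x] of length [#|F|], with
   coordinate [tnth x (enum_rank i)] at the vertex [i]. *)
Definition graphon_density (R : realType) (X : normedModType R)
    (F : test_graph (dual X)) (W : bochner_graphon X) : R :=
  \int[unit_cube R #|F|]_x
    \prod_(e in edges F)
      sg_dec e.1 e.2 (W (tnth x (enum_rank e.1), tnth x (enum_rank e.2))).

Definition graphon_representation_property (R : realType)
    (X : normedModType R) : Prop :=
  forall G : nat -> target_graph X,
    (forall p : R, 1 <= p ->
       has_ubound (range (fun n => graph_pnorm p (G n)))) ->
    (forall F : test_graph (dual X),
       cvgn (fun n => hom_density F (G n))) ->
    exists W : bochner_graphon X, forall F : test_graph (dual X),
      hom_density F (G n) @[n --> \oo] --> graphon_density F W.

(* Main.v *)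
(* Apply the representation property to the one-vertex graphs whose loop carries
   the terms [x n] of a weakly Cauchy sequence. The density of a test graph is
   then a product of numbers [f (x n)], so it converges, and the norms are
   bounded by the uniform boundedness principle. If [W] represents the limit,
   the single edge decorated by [f] gives [f (x n) --> \int f (W)], which is [f a]
   for the Bochner integral [a] of [W].

   Boundedness of [x] is proved with a gliding hump on norming functionals,
   which come from a minimal sublinear functional below the norm (Hahn-Banach);
   the same functionals show that the integrals of simple functions approximating
   [W] form a Cauchy sequence. *)

From HB Require Import structures.
Require Import Defs.
From mathcomp Require Import all_boot all_order all_algebra.
From mathcomp Require Import all_classical all_reals all_analysis.
From mathcomp Require Import measurable_realfun ring lra.

Set Implicit Arguments.
Unset Strict Implicit.
Unset Printing Implicit Defensive.

Import Order.TTheory GRing.Theory Num.Theory.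
Import numFieldNormedType.Exports.

Local Open Scope classical_set_scope.
Local Open Scope ring_scope.

(** * Hahn-Banach: minimal sublinear functionals and norming functionals *)

Section HahnBanach.
Context (R : realType) (X : normedModType R).

(** Homogeneity is asked as an inequality, the form that passes directly to infima; scaling back by
    [a^-1] recovers equality. *)
Definition sublinear (p : X -> R) : Prop :=
  (forall x y, p (x + y) <= p x + p y) /\
  (forall (a : R) x, 0 < a -> p (a *: x) <= a * p x).

Lemma sublinear_scale (p : X -> R) a x :
  sublinear p -> 0 <= a -> p (a *: x) = a * p x.
Proof.
move=> [_ hom]; rewrite le_eqVlt => /predU1P[<-|a0].
  rewrite scale0r mul0r; apply/eqP; rewrite eq_le.
  (* Scaling [0] by [2] gives [0 <= p 0], and scaling it by [2^-1] gives [p 0 <= 0]. *)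
  have h2 : p 0 <= 2 * p 0 by rewrite -{1}(scaler0 _ (2 : R)) hom.
  have h3 : p 0 <= 2^-1 * p 0 by rewrite -{1}(scaler0 _ (2^-1 : R)) hom.
  by apply/andP; split; lra.
apply/eqP; rewrite eq_le hom//= -ler_pdivlMl//.
by rewrite (le_trans _ (hom a^-1 _ _)) ?invr_gt0// scalerA mulVf ?gt_eqF// scale1r.
Qed.

Lemma sublinear_opp_le (p : X -> R) x : sublinear p -> - p (- x) <= p x.
Proof.
move=> sp; have := sp.1 x (- x); rewrite subrr.
by rewrite -(scale0r x) (sublinear_scale _ sp)// mul0r; lra.
Qed.

(* Adding [y] makes [sublinear_drop p y] a sublinear functional below [p] which
   is at most [- p y] at [- y]; so a minimal [p] equals it, and is additive. *)
Definition sublinear_drop (p : X -> R) (y x : X) : R :=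
  inf [set p (x + t *: y) - t * p y | t in [set t | 0 <= t]].

Section Drop.
Variables (p : X -> R) (y : X).
Hypothesis sp : sublinear p.

Lemma sublinear_drop_le x t : 0 <= t ->
  sublinear_drop p y x <= p (x + t *: y) - t * p y.
Proof.
move=> t0; apply: ge_inf; last by exists t.
(* Lower bound: [s * p y = p (s *: y) <= p (x + s *: y) + p (- x)]. *)
exists (- p (- x)) => _ [s /= s0 <-].
have := sp.1 (x + s *: y) (- x); rewrite addrAC subrr add0r.
by rewrite (sublinear_scale _ sp)//; lra.
Qed.

Lemma le_sublinear_drop x c :
  (forall t, 0 <= t -> c <= p (x + t *: y) - t * p y) ->
  c <= sublinear_drop p y x.
Proof.
move=> h; apply: lb_le_inf; first by exists (p (x + 0 *: y) - 0 * p y), 0 => /=.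
by move=> _ [t /= t0 <-]; exact: h.
Qed.

(** If [t] competes in the infimum at [x] and [s] in the one at [x'], then [t + s] competes at
    [x + x']; likewise [a * t] competes at [a *: x]. *)
Lemma sublinear_drop_sublinear : sublinear (sublinear_drop p y).
Proof.
split=> [x x'|a x a0].
  rewrite -lerBlDr; apply: le_sublinear_drop => t t0.
  rewrite lerBlDr -lerBlDl; apply: le_sublinear_drop => s s0.
  have := sublinear_drop_le (x + x') (addr_ge0 t0 s0).
  have := sp.1 (x + t *: y) (x' + s *: y).
  by rewrite addrACA -scalerDl; lra.
rewrite -ler_pdivrMl//; apply: le_sublinear_drop => t t0.
rewrite ler_pdivrMl//.
have := sublinear_drop_le (a *: x) (mulr_ge0 (ltW a0) t0).
by rewrite -scalerA -scalerDr (sublinear_scale _ sp (ltW a0)) mulrBr mulrA.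
Qed.

Lemma sublinear_drop_le_id x : sublinear_drop p y x <= p x.
Proof. by have := sublinear_drop_le x (lexx 0); rewrite scale0r addr0; lra. Qed.

End Drop.

(** Subadditivity: given [p] at [x] and [q] at [y], the smaller of the two serves at both points.
    The bound [b] keeps the infima finite. *)
Lemma sublinear_inf_chain (A : set (X -> R)) (b : X -> R) :
  A !=set0 -> (forall p, A p -> sublinear p) ->
  (forall p x, A p -> b x <= p x) ->
  (forall p q, A p -> A q -> (forall x, p x <= q x) \/ (forall x, q x <= p x)) ->
  sublinear (fun x => inf [set p x | p in A]) /\
  (forall p x, A p -> inf [set q x | q in A] <= p x).
Proof.
move=> [p0 Ap0] sA bA tA.
have le p x : A p -> inf [set q x | q in A] <= p x.
  by move=> Ap; apply: ge_inf; [exists (b x) => _ [q Aq <-]; exact: bA|exists p].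
have geI x c : (forall p, A p -> c <= p x) -> c <= inf [set q x | q in A].
  by move=> h; apply: lb_le_inf; [exists (p0 x), p0|move=> _ [q Aq <-]; exact: h].
split=> //; split=> [x y|a x a0].
  rewrite -lerBlDr; apply: (geI _ _) => p Ap; rewrite lerBlDr -lerBlDl; apply: (geI _ _) => q Aq.
  rewrite lerBlDl; case: (tA p q Ap Aq) => h.
    by rewrite (le_trans (le p _ Ap))// (le_trans ((sA p Ap).1 x y))// lerD2l.
  by rewrite (le_trans (le q _ Aq))// (le_trans ((sA q Aq).1 x y))// lerD2r.
rewrite -ler_pdivrMl//; apply: (geI _ _) => p Ap; rewrite ler_pdivrMl//.
by rewrite (le_trans (le p _ Ap))// (sA p Ap).2.
Qed.

Lemma exists_minimal_sublinear (p0 : X -> R) : sublinear p0 ->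
  exists p, [/\ sublinear p, forall x, p x <= p0 x &
    forall q, sublinear q -> (forall x, q x <= p x) -> q = p].
Proof.
move=> sp0.
pose T := {p : X -> R | sublinear p /\ forall x, p x <= p0 x}.
(* The order is reversed, so that a maximal element for Zorn is a minimal functional. *)
pose below (p q : T) := `[< forall x, sval q x <= sval p x >].
have [||||[p [sp pp0]] minp] := @Zorn T below.
- by move=> p; apply/asboolP.
- move=> p q r /asboolP pq /asboolP qr; apply/asboolP => x.
  exact: le_trans (qr x) (pq x).
- move=> [p hp] [q hq] /asboolP/= qp /asboolP/= pq.
  have epq : p = q by apply/funext => x; apply/eqP; rewrite eq_le pq qp.
  by subst q; congr exist; exact: Prop_irrelevance.
- move=> A tA; have [[q Aq]|A0] := pselect (A !=set0); last first.
    pose t : T := exist _ p0 (conj sp0 (fun=> lexx _)).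
    by exists t => s As; case: A0; exists s.
  pose B := [set sval p | p in A].
  (* Each member [r] satisfies [- p0 (- x) <= - r (- x) <= r x]. *)
  have [||||sB leB] := @sublinear_inf_chain B (fun x => - p0 (- x)).
  + by exists (sval q), q.
  + by move=> _ [[r [sr rp0]] _ <-].
  + move=> _ x [[r [sr rp0]] _ <-] /=.
    by rewrite (le_trans _ (sublinear_opp_le x sr))// lerN2.
  + move=> _ _ [r Ar <-] [s As <-].
    by case: (tA r s Ar As) => /asboolP; [right|left].
  have Bp0 x : inf [set r x | r in B] <= p0 x.
    by rewrite (le_trans (leB (sval q) _ _))//; [exists q|exact: (svalP q).2].
  pose t : T := exist _ (fun x => inf [set r x | r in B]) (conj sB Bp0).
  exists t => s As; apply/asboolP => x /=.
  by apply: leB; exists s.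
exists p; split=> // q sq qp.
have qp0 x : q x <= p0 x by rewrite (le_trans (qp x)).
pose q' : T := exist _ q (conj sq qp0).
by have /(congr1 sval) := minp q' (asboolT qp).
Qed.

Lemma minimal_sublinear_additive (p : X -> R) : sublinear p ->
  (forall q, sublinear q -> (forall x, q x <= p x) -> q = p) ->
  forall x y, p (x + y) = p x + p y.
Proof.
move=> sp minp x y; apply/eqP; rewrite eq_le sp.1/=.
(* With [t = 1] the drop at [x] is at most [p (x + y) - p y]; by minimality the drop is [p]
   itself. *)
have := sublinear_drop_le y sp x ler01.
rewrite (minp _ (sublinear_drop_sublinear y sp) (sublinear_drop_le_id y sp)).
by rewrite scale1r; lra.
Qed.

Lemma exists_linear_below (p0 : X -> R) : sublinear p0 ->
  exists f : {linear X -> R^o}, forall x, f x <= p0 x.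
Proof.
move=> /exists_minimal_sublinear[p [sp pp0 /(minimal_sublinear_additive sp) pD]].
have pN x : p (- x) = - p x.
  apply/eqP; rewrite -addr_eq0 -pD addrC subrr -(scale0r x).
  by rewrite (sublinear_scale _ sp)// mul0r.
have plin : linear (p : X -> R^o).
  move=> a x y; rewrite pD; congr (_ + _).
  have [a0|a0] := leP 0 a; first exact: sublinear_scale.
  rewrite -[LHS]opprK -pN -scaleNr (sublinear_scale _ sp) ?oppr_ge0 ?ltW//.
  by rewrite mulNr opprK.
pose f : {linear X -> R^o} :=
  HB.pack (p : X -> R^o) (GRing.isLinear.Build _ _ _ _ _ plin).
by exists f.
Qed.

Lemma bounded_functional_continuous (f : {linear X -> R^o}) (C : R) :
  (forall x, `|f x| <= C * `|x|) -> continuous f.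
Proof.
move=> fC; apply: bounded_linear_continuous; apply/linear_boundedP.
apply: filterS (nbhs_pinfty_ge (num_real C)) => r Cr x.
by rewrite (le_trans (fC x))// ler_wpM2r.
Qed.

(** The norm dropped along [x0] is at most [- |x0|] at [- x0], so a linear functional below it has
    [f x0 >= |x0|]. *)
Lemma exists_norming_functional (x0 : X) :
  exists f : dual X, f x0 = `|x0| /\ forall x, `|f x| <= `|x|.
Proof.
have sn : sublinear (fun x : X => `|x|).
  by split=> [x y|a x a0]; [exact: ler_normD|rewrite normrZ gtr0_norm].
have [f fle] := exists_linear_below (sublinear_drop_sublinear x0 sn).
have fn x : f x <= `|x| := le_trans (fle x) (sublinear_drop_le_id x0 sn x).
have fabs x : `|f x| <= `|x|.
  by rewrite ler_norml fn andbT lerNl -linearN (le_trans (fn _)) ?normrN.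
have fc : continuous f.
  by apply: (@bounded_functional_continuous f 1) => x; rewrite mul1r.
exists (Dual fc); split=> //=; apply/eqP; rewrite eq_le fn/=.
have := le_trans (fle (- x0)) (sublinear_drop_le x0 sn (- x0) ler01).
by rewrite scale1r addNr normr0 linearN; lra.
Qed.

End HahnBanach.

(** The explicit rate serves for the limit of the humps; convergence alone serves for integrals of
    simple functions. *)
Lemma dist_le_cvgn (R : realType) (V : completeNormedModType R)
    (u : nat -> V) (b : nat -> R) :
  (forall n m, `|u n - u m| <= b n + b m) -> b n @[n --> \oo] --> 0 ->
  cvgn u /\ forall n, `|limn u - u n| <= b n.
Proof.
move=> ub b0; have cu : cvgn u.
  apply/cauchy_cvgP/cauchy_ballP => e e0; rewrite near_map2.
  have e20 : 0 < e / 2 by rewrite divr_gt0.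
  have [N _ bN] : \forall n \near \oo, b n < e / 2 := cvgr_lt _ b0 _ e20.
  exists ([set n | (N <= n)%N], [set n | (N <= n)%N]) => /=.
    by split; exists N.
  move=> [n m] [/= Nn Nm]; rewrite -ball_normE/= (le_lt_trans (ub n m))//.
  by have := bN _ Nn; have := bN _ Nm; rewrite /=; lra.
split=> // n.
have h : `|u m - u n| - b m @[m --> \oo] --> `|limn u - u n| - 0.
  by apply: cvgB b0; apply: cvg_norm; apply: cvgB cu _; exact: cvg_cst.
rewrite -[leLHS]subr0; apply: cvgr_to_le h _; apply: nearW => m.
by have := ub m n; lra.
Qed.

(** * Gliding hump and uniform boundedness *)

Section GlidingHump.
Context (R : realType) (X : normedModType R).
Variables (y : nat -> X) (psi : nat -> dual X).
Hypothesis psi1 : forall k z, `|psi k z| <= `|z|.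
Hypothesis psiy : forall k, psi k (y k) = `|y k|.

(* The sign of the [k]-th term is chosen so that it does not cancel, at [y k],
   the sum of the previous ones. *)
Fixpoint hump (k : nat) (z : X) : R :=
  if k is j.+1 then
    hump j z + (if 0 <= hump j (y j) then 3^-1 ^+ j else - 3^-1 ^+ j) * psi j z
  else 0.

Lemma hump_linear k : linear (hump k : X -> R^o).
Proof.
elim: k => [|k IH] a u v /=; first by rewrite scaler0 addr0.
by rewrite IH linearP /GRing.scale /=; ring.
Qed.

Lemma hump_peak k : 3^-1 ^+ k * `|y k| <= `|hump k.+1 (y k)|.
Proof.
have p0 : 0 <= 3^-1 ^+ k * `|y k| :> R by rewrite mulr_ge0// exprn_ge0// invr_ge0.
rewrite /= psiy; case: ifPn => [h|]; first by rewrite ger0_norm; lra.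
by rewrite -ltNge => h; rewrite ltr0_norm; lra.
Qed.

(** The constant is the geometric sum of [3^-1 ^+ j] for [n <= j < n + m], kept exact so that the
    induction closes. *)
Lemma hump_dist n m z :
  `|hump (n + m) z - hump n z| <=
  3 / 2 * (3^-1 ^+ n - 3^-1 ^+ (n + m)) * `|z|.
Proof.
elim: m => [|m IH]; first by rewrite addn0 !subrr normr0 mulr0 mul0r.
rewrite addnS /= addrAC (le_trans (ler_normD _ _))//.
set c := (if _ then _ else _).
have c1 : `|c * psi (n + m)%N z| <= 3^-1 ^+ (n + m) * `|z|.
  rewrite normrM ler_pM// /c.
  by case: ifP => _; rewrite ?normrN ger0_norm ?exprn_ge0 ?invr_ge0.
apply: le_trans (lerD IH c1) _.
by rewrite exprS; lra.
Qed.

(** The terms after the [k]-th contribute at [y k] at most [3 / 2 * 3^-1 ^+ k.+1 * |y k|], which is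
    half of the peak in [hump_peak]; the other half survives. *)
Lemma hump_limit : exists f : dual X, forall k,
  2^-1 * 3^-1 ^+ k * `|y k| <= `|f (y k)|.
Proof.
pose b z n : R := 3 / 2 * 3^-1 ^+ n * `|z : X|.
have le_b z n m : `|hump n z - hump m z| <= b z n + b z m.
  wlog nm : n m / (n <= m)%N => [hw|].
    have /orP[/hw//|/hw h] := leq_total n m.
    by rewrite distrC (addrC (b z n)).
  rewrite distrC -(subnKC nm) (le_trans (hump_dist _ _ _))// /b -mulrDl.
  rewrite ler_wpM2r// -mulrDr ler_wpM2l// lerD2l.
  have : 0 <= 3^-1 ^+ (n + (m - n)) :> R by rewrite exprn_ge0// invr_ge0.
  by lra.
have b0 z : b z n @[n --> \oo] --> 0.
  rewrite -(mul0r `|z|); apply: cvgMl; rewrite -(mulr0 (3 / 2)); apply: cvgMr.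
  by apply: cvg_expr; rewrite ger0_norm; lra.
have H z := dist_le_cvgn (le_b z) (b0 z).
pose f (z : X) : R^o := limn (hump ^~ z).
have flin : linear f.
  move=> a u v; apply/cvg_lim => //.
  under eq_fun do rewrite hump_linear.
  by apply: cvgD; [apply: cvgZr; exact: (H u).1|exact: (H v).1].
pose F : {linear X -> R^o} :=
  HB.pack f (GRing.isLinear.Build _ _ _ _ _ flin).
have Fc : continuous F.
  apply: (@bounded_functional_continuous _ _ F (3 / 2)) => z.
  by have := (H z).2 0; rewrite /= subr0 /b expr0 mulr1.
exists (Dual Fc) => k /=.
(* [hump k.+1] is the first partial sum that contains the [k]-th term. *)
have := (H (y k)).2 k.+1; rewrite distrC /b exprS.
have := lerB_dist (hump k.+1 (y k)) (f (y k)); have := hump_peak k.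
set h := `|hump k.+1 (y k) - _|; lra.
Qed.

End GlidingHump.

Lemma weakly_bounded_bounded (R : realType) (X : normedModType R)
    (x : nat -> X) :
  (forall f : dual X, exists M, forall n, `|f (x n)| <= M) ->
  exists M, forall n, `|x n| <= M.
Proof.
move=> fx; apply: contrapT => nb.
have {}nb M : exists n, M <= `|x n|.
  apply: contrapT => h; apply: nb; exists M => n.
  by apply/ltW; rewrite ltNge; apply/negP => h'; apply: h; exists n.
(* The factor [2 * 3 ^+ k] offsets the loss in [hump_limit], so that [|f (x (i k))| >= k]. *)
have [i hi] := choice (fun k : nat => nb (2 * 3 ^+ k * k%:R)).
have [psi hpsi] := choice (fun k => exists_norming_functional (x (i k))).
have [f hf] := hump_limit (fun k => (hpsi k).2) (fun k => (hpsi k).1).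
have [M hM] := fx f.
have [k Mk] : exists k : nat, M < k%:R.
  by exists (Num.truncn M).+1; rewrite truncnS_gt.
have := hf k; have := hM (i k).
have : k%:R <= 2^-1 * 3^-1 ^+ k * `|x (i k)| :> R.
  rewrite -ler_pdivrMl ?mulr_gt0 ?exprn_gt0 ?invr_gt0//.
  by rewrite (le_trans _ (hi k))// invfM exprVn !invrK.
lra.
Qed.

Lemma weakly_cauchy_bounded (R : realType) (X : normedModType R)
    (x : nat -> X) :
  weakly_cauchy x -> exists M, forall n, `|x n| <= M.
Proof.
move=> wx; apply: weakly_bounded_bounded => f.
have /cauchy_cvgP/cvg_seq_bounded := wx f.
by move=> [M [_ hM]]; exists (M + 1) => n; apply: hM; rewrite // ltrDl.
Qed.

Lemma dual_bounded (R : realType) (X : normedModType R) (f : dual X) :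
  exists2 C, 0 <= C & forall x, `|f x| <= C * `|x|.
Proof.
have /linear_bounded_continuous/linear_boundedP := @dual_continuous _ _ f.
move=> [M [_ hM]]; exists (`|M| + 1) => [|x]; first by rewrite addr_ge0.
by apply: hM; rewrite ltr_pwDr// ler_norm.
Qed.

(** * Simple functions *)

Section SimpleFun.
Context d (T : measurableType d).

(** The range is finite, so the preimage of any set is a finite union of measurable level sets; [X]
    carries no sigma-algebra. *)
Lemma simple_fun_measurable (X : Type) (s : T -> X) (A : set X) :
  simple_fun s -> measurable (s @^-1` A).
Proof.
move=> [fs ms].
have -> : s @^-1` A = \bigcup_(a in range s `&` A) s @^-1` [set a].
  apply/seteqP; split=> [z Az|z [a [_ Aa] /= sza]]; last by rewrite /= sza.
  by exists (s z) => //; split=> //; exists z.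
by apply: fin_bigcup_measurable => //; apply: sub_finite_set fs => a [].
Qed.

Lemma simple_fun_comp_measurable (X : Type) d' (Y : measurableType d')
    (s : T -> X) (F : X -> Y) :
  simple_fun s -> measurable_fun setT (F \o s).
Proof.
move=> ss _ B _; rewrite setTI comp_preimage.
exact: simple_fun_measurable.
Qed.

Lemma simple_fun_pair (X Y : Type) (s : T -> X) (t : T -> Y) :
  simple_fun s -> simple_fun t -> simple_fun (fun z => (s z, t z)).
Proof.
move=> ss st; split.
  apply: (@sub_finite_set _ _ (range s `*` range t)) => [_ [z _ <-]|].
    by split; exists z.
  by apply: finite_setX; [exact: ss.1|exact: st.1].
move=> [a b].
have -> : (fun z => (s z, t z)) @^-1` [set (a, b)] =
    s @^-1` [set a] `&` t @^-1` [set b].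
  by apply/seteqP; split=> z /= [ea eb]; [split|rewrite ea eb].
by apply: measurableI; [exact: ss.2|exact: st.2].
Qed.

(** Serves twice in [bochner_integral]: to discard a null set, and to truncate values that are too
    large. *)
Lemma simple_fun_cut (X : nmodType) (s : T -> X) (A : set T) :
  simple_fun s -> measurable A ->
  simple_fun (fun z => if z \in A then s z else 0).
Proof.
move=> ss mA; split.
  apply: (@sub_finite_set _ _ (range s `|` [set 0])) => [_ [z _ <-]|].
    by case: ifP => _; [left; exists z|right].
  by rewrite finite_setU; split; [exact: ss.1|exact: finite_set1].
move=> a.
have -> : (fun z => if z \in A then s z else 0) @^-1` [set a] =
    (A `&` s @^-1` [set a]) `|` (~` A `&` [set _ | 0 = a]).
  apply/seteqP; split=> z /=.
    by case: ifPn => [/set_mem|/negP]; [left|right; split=> // /mem_set].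
  by case=> [[Az <-]|[nAz <-]]; [rewrite mem_set|rewrite memNset].
apply: measurableU; first by apply: measurableI => //; exact: ss.2.
apply: measurableI; first exact: measurableC.
have [a0|a0] := pselect (0 = a).
  have -> : [set _ : T | 0 = a] = setT by apply/seteqP; split.
  exact: measurableT.
have -> : [set _ : T | 0 = a] = set0 by apply/seteqP; split.
exact: measurable0.
Qed.

End SimpleFun.

(** * Integrals of dominated everywhere limits of simple functions *)

Section BochnerIntegral.
Context d (T : measurableType d) (R : realType).
Context (mu : {finite_measure set T -> \bar R}) (X : completeNormedModType R).

Lemma simple_fun_real_integrable (s : T -> X) (F : X -> R) :
  simple_fun s -> mu.-integrable setT (fun z => (F (s z))%:E).
Proof.
move=> ss; have /finite_seqP[r hr] := ss.1.
have mF : measurable_fun setT (fun z => F (s z)).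
  exact: (@simple_fun_comp_measurable _ _ X _ _ s F).
pose M := \sum_(v <- r) `|F v|.
apply: (le_integrable _ _ _ (finite_measure_integrable_cst mu M measurableT)) => //.
  exact/measurable_EFinP.
move=> z _ /=; rewrite lee_fin.
have zr : s z \in r by have : range s (s z); [exists z|rewrite hr].
by rewrite [leRHS]ger0_norm ?sumr_ge0// /M (big_rem _ zr)/= lerDl sumr_ge0.
Qed.

Lemma simple_fun_integral (s : T -> X) : simple_fun s ->
  exists a : X, forall f : dual X, f a = \int[mu]_z f (s z).
Proof.
move=> ss; have /finite_seqP[r0 hr0] := ss.1.
(* Without repetitions, exactly one term of the sum in [fE] is selected by the indicators. *)
pose r := undup r0.
exists (\sum_(v <- r) fine (mu (s @^-1` [set v])) *: v) => f.
have fE z : f (s z) = \sum_(v <- r) f v * \1_(s @^-1` [set v]) z.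
  have zr : s z \in r.
    by rewrite mem_undup; have : range s (s z); [exists z|rewrite hr0].
  rewrite (big_rem _ zr)/= indicE mem_set// mulr1 big1_seq ?addr0// => v.
  rewrite mem_rem_uniq ?undup_uniq// inE => /andP[_ /andP[vz _]].
  by rewrite indicE memNset ?mulr0//= => zv; rewrite zv eqxx in vz.
have iI v : mu.-integrable setT (fun z => (\1_(s @^-1` [set v]) z)%:E).
  by apply: integrable_indic; exact: ss.2.
rewrite /Rintegral; under eq_integral do rewrite fE -sumEFin.
rewrite (integral_sum measurableT (f := fun v z => (f v * \1_(s @^-1` [set v]) z)%:E)); last first.
  by move=> v; exact: (integrableZl measurableT (f v) (iI v)).
rewrite linear_sum/=.
have iE v : (\int[mu]_z (f v * \1_(s @^-1` [set v]) z)%:E =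
    (f v * fine (mu (s @^-1` [set v])))%:E)%E.
  under eq_integral do rewrite EFinM.
  rewrite integralZl// integral_indic ?setIT//; last exact: ss.2.
  by rewrite EFinM fineK// fin_num_measure//; exact: ss.2.
under [in RHS]eq_bigr do rewrite iE.
rewrite sumEFin/=; apply: eq_bigr => v _.
by rewrite linearZ /= mulrC.
Qed.

Variables (t : nat -> T -> X) (w : T -> X) (h : T -> R).
Hypothesis st : forall n, simple_fun (t n).
Hypothesis tw : forall z, t n z @[n --> \oo] --> w z.

Lemma simple_limit_norm_measurable (c : X) :
  measurable_fun setT (fun z => `|c - w z|).
Proof.
apply: (@measurable_fun_cvg _ _ _ _ (fun n z => `|c - t n z|)).
  by move=> m; exact: (@simple_fun_comp_measurable _ _ X _ _ (t m) (fun x => `|c - x|)).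
by move=> z _; apply: cvg_norm; exact: cvgB (cvg_cst _) (@tw z).
Qed.

Lemma simple_limit_dual_measurable (f : dual X) :
  measurable_fun setT (fun z => f (w z) : R).
Proof.
apply: (@measurable_fun_cvg _ _ _ _ (fun n z => f (t n z))).
  by move=> m; exact: (@simple_fun_comp_measurable _ _ X _ _ (t m) f).
by move=> z _; apply: continuous_cvg (@tw z); exact: dual_continuous.
Qed.

(** The pair of two simple functions is simple, so the distances to [t m] are measurable, and so is
    their limit in [m]. *)
Lemma simple_limit_dist_measurable n :
  measurable_fun setT (fun z => `|t n z - w z|).
Proof.
apply: (@measurable_fun_cvg _ _ _ _ (fun m z => `|t n z - t m z|)).
  move=> m; exact: (@simple_fun_comp_measurable _ _ _ _ _ _
    (fun x : X * X => `|x.1 - x.2|) (simple_fun_pair (st n) (st m))).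
by move=> z _; apply: cvg_norm; exact: cvgB (cvg_cst _) (@tw z).
Qed.

Hypothesis th : forall n z, `|t n z| <= h z.
Hypothesis ih : mu.-integrable setT (EFin \o h).

Let wh z : `|w z| <= h z.
Proof.
by apply: cvgr_to_le (cvg_norm (@tw z)) _; apply: nearW => n; exact: th.
Qed.

Let h0 z : 0 <= h z. Proof. exact: le_trans (normr_ge0 _) (wh z). Qed.

Lemma simple_limit_dual_integrable (f : dual X) :
  mu.-integrable setT (fun z => (f (w z))%:E).
Proof.
have [C C0 fC] := dual_bounded f.
apply: (le_integrable _ _ _ (integrableZl _ C ih)) => //.
  by apply/measurable_EFinP; exact: simple_limit_dual_measurable.
move=> z _ /=; rewrite lee_fin normrM (ger0_norm C0) (le_trans (fC _))//.
by rewrite ler_wpM2l// (le_trans (wh z))// ler_norm.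
Qed.

Lemma simple_limit_dist_integrable n :
  mu.-integrable setT (fun z => (`|t n z - w z|)%:E).
Proof.
apply: (le_integrable _ _ _ (integrableZl _ 2 ih)) => //.
  by apply/measurable_EFinP; exact: simple_limit_dist_measurable.
move=> z _ /=; rewrite lee_fin normr_id normrM !ger0_norm//.
by have := ler_normB (t n z) (w z); have := wh z; have := th n z; lra.
Qed.

Lemma simple_limit_dist_cvg : \int[mu]_z `|t n z - w z| @[n --> \oo] --> 0.
Proof.
have [|||||_ _] := @dominated_convergence _ _ _ mu setT measurableT
  (fun n z => (`|t n z - w z|)%:E) (cst 0%E) (fun z => (2%:E * (h z)%:E)%E).
- by move=> n; apply/measurable_EFinP; exact: simple_limit_dist_measurable.
- exact: measurable_cst.
- apply: aeW => z _; apply/fine_cvgP; split; first exact: nearW.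
  rewrite /comp/= -(normr0 X) -(subrr (w z)).
  by apply: cvg_norm; exact: cvgB (@tw z) (cvg_cst _).
- exact: integrableZl.
- apply: aeW => z n _ /=; rewrite lee_fin normr_id.
  by have := ler_normB (t n z) (w z); have := wh z; have := th n z; lra.
- by rewrite integral0 => /fine_cvgP[].
Qed.

Lemma simple_limit_dual_cvg (f : dual X) :
  \int[mu]_z f (t n z) @[n --> \oo] --> \int[mu]_z f (w z).
Proof.
have [C C0 fC] := dual_bounded f.
have [|||||_ _] := @dominated_convergence _ _ _ mu setT measurableT
  (fun n z => (f (t n z))%:E) (fun z => (f (w z))%:E)
  (fun z => (C%:E * (h z)%:E)%E).
- by move=> n; exact: (measurable_int mu (simple_fun_real_integrable f (st n))).
- by apply/measurable_EFinP; exact: simple_limit_dual_measurable.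
- apply: aeW => z _; apply/fine_cvgP; split; first exact: nearW.
  by apply: continuous_cvg (@tw z); exact: dual_continuous.
- exact: integrableZl.
- apply: aeW => z n _ /=; rewrite lee_fin (le_trans (fC _))//.
  by rewrite ler_wpM2l.
- move=> hc; apply: fine_cvg; rewrite fineK//.
  exact/integrable_fin_num/simple_limit_dual_integrable.
Qed.

(** With [a n] the integral of [t n] and [f] norming [a n - a m], the norm of this difference is the
    integral of [f (t n z - t m z)], hence at most the sum of the mean distances of [t n] and [t m]
    to [w]. *)
Lemma simple_limit_integral :
  exists a : X, forall f : dual X, f a = \int[mu]_z f (w z).
Proof.
have [a ha] := choice (fun n => simple_fun_integral (st n)).
pose b n := \int[mu]_z `|t n z - w z|.
have ab n m : `|a n - a m| <= b n + b m.
  have [f [fE f1]] := exists_norming_functional (a n - a m).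
  rewrite -fE linearB/= !ha -RintegralB//; last 2 first.
    exact: simple_fun_real_integrable.
    exact: simple_fun_real_integrable.
  rewrite -RintegralD//; [|exact: simple_limit_dist_integrable..].
  apply: le_Rintegral => //.
  - exact: (integrableB measurableT (simple_fun_real_integrable f (st n))
      (simple_fun_real_integrable f (st m))).
  - exact: (integrableD measurableT (simple_limit_dist_integrable n)
      (simple_limit_dist_integrable m)).
  move=> z _; rewrite -linearB (le_trans (ler_norm _))// (le_trans (f1 _))//.
  by rewrite [`|t m z - _|]distrC ler_distD.
have [ca _] := dist_le_cvgn ab simple_limit_dist_cvg.
exists (limn a) => f.
have h1 : f (a n) @[n --> \oo] --> f (limn a).
  by apply: continuous_cvg ca; exact: dual_continuous.
have h2 := @simple_limit_dual_cvg f.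
have h3 : (fun n => f (a n)) = (fun n => \int[mu]_z f (t n z)) by apply/funext.
by rewrite h3 in h1; exact: cvg_unique h1 h2.
Qed.

End BochnerIntegral.

(* The integral of a nonnegative function is a supremum over the simple functions
   below it, also when the function is not measurable. A Bochner measurable [W]
   is only almost everywhere equal to a function with measurable [f \o W], and
   the measures are not complete, so such integrals cannot be avoided. *)
Section LowerIntegral.
Local Open Scope ereal_scope.
Context d (T : measurableType d) (R : realType) (mu : {measure set T -> \bar R}).

Import HBNNSimple.

Lemma ge0_le_lower_integral (f g : T -> \bar R) :
  (forall z, 0 <= f z) -> (forall z, f z <= g z) ->
  \int[mu]_z f z <= \int[mu]_z g z.
Proof.
move=> f0 fg.
rewrite !ge0_integralTE//; last by move=> z; exact: le_trans (f0 z) (fg z).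
apply: ereal_sup_le => _ [k /= kf <-].
by exists k => //= z; exact: le_trans (kf z) (fg z).
Qed.

(** A simple function below [f], set to [0] on [N], lies below [g] and keeps its integral; the roles
    of [f] and [g] are symmetric. *)
Lemma ge0_lower_integral_eq_off_null (N : set T) (f g : T -> \bar R) :
  measurable N -> mu N = 0 ->
  (forall z, 0 <= f z) -> (forall z, 0 <= g z) ->
  (forall z, ~ N z -> f z = g z) ->
  \int[mu]_z f z = \int[mu]_z g z.
Proof.
move=> mN N0.
wlog suff : f g / (forall z, 0 <= f z) -> (forall z, 0 <= g z) ->
    (forall z, ~ N z -> f z = g z) -> \int[mu]_z f z <= \int[mu]_z g z.
  move=> le f0 g0 fg; apply/eqP; rewrite eq_le !le// => z Nz.
  by rewrite fg.
move=> f0 g0 fg; rewrite !ge0_integralTE//.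
apply: ge_ereal_sup => _ [k /= kf <-].
have mCN := measurableC mN.
have kE z : proj_nnsfun k mCN z = (k \_ (~` N)) z by rewrite mrestrict.
apply: ereal_sup_ubound; exists (proj_nnsfun k mCN).
  move=> z; rewrite kE patchE; case: ifPn => [/set_mem|_]; last by rewrite g0.
  by move=> /fg <-.
rewrite -!integralT_nnsfun; apply: ae_eq_integral => //.
- by apply/measurable_EFinP; exact: measurable_funP.
- by apply/measurable_EFinP; exact: measurable_funP.
exists N; split=> // z /= h; apply: contrapT => Nz; apply: h => _.
have := kE z; rewrite patchE mem_set// => e.
exact: (congr1 EFin e).
Qed.

Lemma lower_integral_eq_off_null (N : set T) (f g : T -> \bar R) :
  measurable N -> mu N = 0 -> (forall z, ~ N z -> f z = g z) ->
  \int[mu]_z f z = \int[mu]_z g z.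
Proof.
move=> mN N0 fg; rewrite integralE [RHS]integralE.
congr (_ - _); apply: (ge0_lower_integral_eq_off_null mN N0) => //.
- by move=> z Nz; rewrite !funeposE fg.
- by move=> z Nz; rewrite !funenegE fg.
Qed.

End LowerIntegral.

(** Setting everything to [0] on the exceptional null set makes the convergence hold everywhere, and
    truncation by an integrable [h] makes it dominated. The result exposes [w] and [N] because
    [f \o W] itself may fail to be measurable. *)
Lemma bochner_integral (d : measure_display) (T : measurableType d)
    (R : realType) (mu : {finite_measure set T -> \bar R})
    (X : completeNormedModType R) (W : T -> X) :
  bochner_measurable mu W -> (\int[mu]_z (`|W z|)%:E < +oo)%E ->
  exists a : X, exists w : T -> X, exists N : set T,
    [/\ measurable N, mu N = 0, forall z, ~ N z -> w z = W z &
    forall f : dual X, mu.-integrable setT (fun z => (f (w z))%:E) /\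
      f a = \int[mu]_z f (w z)].
Proof.
move=> [s [ss [N [mN N0 sN]]]] iW.
have mCN := measurableC mN.
pose w z := if z \in ~` N then W z else 0.
pose s' n z := if z \in ~` N then s n z else 0.
have ss' n : simple_fun (s' n) := simple_fun_cut (ss n) mCN.
have sw' z : s' n z @[n --> \oo] --> w z.
  rewrite /s' /w; case: ifPn => [/set_mem Nz|_]; last exact: cvg_cst.
  by apply: contrapT => h; apply: Nz; apply: sN.
have mw : measurable_fun setT (fun z => `|w z|).
  have := simple_limit_norm_measurable ss' sw' 0.
  by under eq_fun do rewrite sub0r normrN.
(* The summand [1] makes [|w z| < h z] strict, so at each point the truncation is eventually
   inactive. *)
pose h z : R := 1 + `|w z|.
have iw : mu.-integrable setT (fun z => (`|w z|)%:E).
  apply/integrableP; split; first exact/measurable_EFinP.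
  apply: le_lt_trans iW; apply: ge0_le_lower_integral => z; first exact: abse_ge0.
  rewrite /= normr_id lee_fin /w; case: ifP => // _.
  by rewrite normr0.
have ih : mu.-integrable setT (EFin \o h).
  exact: (integrableD measurableT
    (finite_measure_integrable_cst mu 1 measurableT) iw).
have mA n : measurable [set z | `|s' n z| <= h z].
  rewrite -[X in measurable X]setTI.
  apply: measurable_fun_le => //.
    exact: (@simple_fun_comp_measurable _ _ X _ _ (s' n) (fun x => `|x|)).
  exact: measurable_funD.
pose t n z := if z \in [set z | `|s' n z| <= h z] then s' n z else 0.
have st n : simple_fun (t n) := simple_fun_cut (ss' n) (mA n).
have th n z : `|t n z| <= h z.
  rewrite /t; case: ifPn => [/set_mem//|_].
  by rewrite normr0 /h addr_ge0.
have tw z : t n z @[n --> \oo] --> w z.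
  have := sw' z; apply: cvg_trans; apply: near_eq_cvg.
  have : `|w z| < h z by rewrite /h ltrDr.
  move/(cvgr_lt _ (cvg_norm (@sw' z))); apply: filterS => n hn.
  by rewrite /t mem_set//= ltW.
have [a ha] := simple_limit_integral st tw th ih.
exists a, w, N; split=> // [z Nz|f]; first by rewrite /w mem_set.
by split=> //; exact: (simple_limit_dual_integrable st tw th ih).
Qed.

(** * Change of variables along a measure-preserving map *)

Section IntegralImage.
Context d1 d2 (T1 : measurableType d1) (T2 : measurableType d2) (R : realType).
Variables (mu1 : {measure set T1 -> \bar R}) (mu2 : {measure set T2 -> \bar R}).
Variable phi : T1 -> T2.
Hypothesis mphi : measurable_fun setT phi.
Hypothesis phiE : forall A, measurable A -> mu1 (phi @^-1` A) = mu2 A.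

Lemma ge0_integral_image (g : T2 -> \bar R) :
  measurable_fun setT g -> (forall z, 0 <= g z)%E ->
  (\int[mu1]_x g (phi x) = \int[mu2]_z g z)%E.
Proof.
move=> mg g0.
have /= e := ge0_integral_pushforward mphi mu1 measurableT mg (fun z _ => g0 z).
rewrite preimage_setT in e; rewrite -e.
by apply: eq_measure_integral => A mA _; exact: phiE.
Qed.

(** The preimage of [N] is null, so [F] can be replaced by the measurable [g] before the change of
    variables. *)
Lemma integral_image_off_null (N : set T2) (F g : T2 -> \bar R) :
  measurable N -> mu2 N = 0%E -> measurable_fun setT g ->
  (forall z, ~ N z -> F z = g z) ->
  (\int[mu1]_x F (phi x) = \int[mu2]_z g z)%E.
Proof.
move=> mN N0 mg Fg.
have mpN : measurable (phi @^-1` N).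
  by rewrite -[X in measurable X]setTI; exact: mphi.
rewrite (lower_integral_eq_off_null (g := g \o phi) mpN); last 2 first.
- by rewrite phiE.
- by move=> z Nz /=; rewrite Fg.
rewrite integralE [RHS]integralE; congr (_ - _)%E.
- rewrite -ge0_integral_image//; last exact: measurable_funepos.
  by apply: eq_integral => x _; rewrite !funeposE.
- rewrite -ge0_integral_image//; last exact: measurable_funeneg.
  by apply: eq_integral => x _; rewrite !funenegE.
Qed.

End IntegralImage.

(** * The two-dimensional cube and the unit square *)

Section UnitCube.
Context (R : realType).
Local Notation mR := (measurableTypeR R).

(** The measure of [unit_square], retyped as a probability so that [bochner_integral], stated for
    finite measures, applies. *)
Definition unit_square_probability : probability (mR * mR)%type R :=
  (@unit_lebesgue R \x @unit_lebesgue R)%E.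

Definition first_two (x : 2.-tuple mR) : mR * mR :=
  (tnth x ord0, tnth x (lift ord0 ord0)).

Lemma measurable_first_two : measurable_fun setT first_two.
Proof. by apply/measurable_fun_pairP; split; exact: measurable_tnth. Qed.

(** Both sides unfold to iterated integrals; the innermost factor of the cube is the Dirac mass at
    the empty tuple, whose value on a section is an indicator. *)
Lemma unit_cube_first_two (A : set (mR * mR)) : measurable A ->
  unit_cube R 2 (first_two @^-1` A) = unit_square R A.
Proof.
move=> mA.
rewrite /unit_cube /power_measure /= /cons_measure /pushforward.
rewrite /unit_square /product_measure1 /=.
apply: eq_integral => x _ /=.
rewrite /cons_measure /pushforward /product_measure1 /=.
rewrite -[xsection A x]setIT -integral_indic//; last exact: measurable_xsection.
apply: eq_integral => y _ /=.
rewrite diracE indicE; congr ((nat_of_bool _)%:R%:E); rewrite !mem_xsection.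
apply/idP/idP => [/set_mem/xsectionP h|/set_mem h]; apply/mem_set; first exact: h.
by apply/xsectionP; exact: h.
Qed.

End UnitCube.

(** * One-vertex target graphs and the single-edge test graph *)

Section Loop.
Context (R : realType) (X : normedModType R) (a : X).

Definition loop_graph : target_graph X :=
  @TargetGraph X unit (eq_leq (esym card_unit)) (fun _ _ => a)
    (fun _ _ => erefl).

Lemma loop_graph_density (F : test_graph (dual X)) :
  hom_density F loop_graph = \prod_(e in edges F) sg_dec e.1 e.2 a.
Proof.
rewrite /hom_density card_unit expr1n invr1 mul1r /=.
by rewrite sumr_const card_ffun card_unit exp1n.
Qed.

Lemma loop_graph_pnorm (p : R) : 1 <= p -> graph_pnorm p loop_graph = `|a|.
Proof.
move=> p1; rewrite /graph_pnorm card_unit expr1n invr1 mul1r.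
rewrite /= !sumr_const !card_unit -powRrM mulfV ?powRr1//.
by rewrite gt_eqF// (lt_le_trans ltr01).
Qed.

End Loop.

Section SingleEdge.
Context (R : realType) (X : normedModType R).

Definition single_edge (f : dual X) : test_graph (dual X) :=
  @TestGraph (dual X) 'I_2 (fun i j => i != j)
    (fun i j => congr1 negb (eq_sym i j)) (fun i => congr1 negb (eqxx i))
    (fun _ _ => f) (fun _ _ _ => erefl).

Lemma single_edge_edges (f : dual X) :
  edges (single_edge f) = [set (ord0, lift ord0 ord0)]%SET.
Proof.
apply/setP => -[i j]; rewrite !inE /= !enum_rank_ord xpair_eqE -!val_eqE /=.
by case: i j => [[|[|//]] ?] [[|[|//]] ?].
Qed.

(** The dimension in [graphon_density] is the cardinal of ['I_2], equal to [2] only through a proof;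
    a variable [n] lets this equation be substituted. *)
Lemma unit_cube_cast (n : nat) (e : 2 = n)
    (g : measurableTypeR R * measurableTypeR R -> R) :
  \int[unit_cube R n]_x
    g (tnth x (cast_ord e ord0), tnth x (cast_ord e (lift ord0 ord0))) =
  \int[unit_cube R 2]_x g (first_two x).
Proof.
by subst n; apply: eq_Rintegral => x _; rewrite !cast_ord_id.
Qed.

Lemma single_edge_density (f : dual X) (W : bochner_graphon X) :
  graphon_density (single_edge f) W =
  \int[unit_cube R 2]_x f (W (first_two x)).
Proof.
rewrite /graphon_density -(unit_cube_cast (esym (card_ord 2)) (f \o W)).
apply: eq_Rintegral => x _.
by rewrite single_edge_edges big_set1 /= !enum_rank_ord.
Qed.

End SingleEdge.

Lemma is_cvg_prod (R : realType) (I : Type) (s : seq I) (u : nat -> I -> R) :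
  (forall i, cvgn (u ^~ i)) -> cvgn (fun n => \prod_(i <- s) u n i).
Proof.
move=> cu; elim: s => [|i s IH].
  by under eq_fun do rewrite big_nil; exact: is_cvg_cst.
by under eq_fun do rewrite big_cons; exact: is_cvgM (cu i) IH.
Qed.

Theorem proposition3p1 (R : realType) (X : completeNormedModType R) :
  graphon_representation_property X -> weakly_sequentially_complete X.
Proof.
move=> rep x wx; have [M xM] := weakly_cauchy_bounded wx.
have [p p1|F|W hW] := rep (fun n => loop_graph (x n)).
- by exists M => _ [n _ <-]; rewrite loop_graph_pnorm.
- under eq_fun do rewrite loop_graph_density -big_enum.
  by apply: is_cvg_prod => e; exact/cauchy_cvgP/wx.
(* The case [p = 1] of the integrability of [W]. *)
have iW : (\int[unit_square R]_z (`|W z|)%:E < +oo)%E.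
  have := bg_Lp W (lexx 1); rewrite /finite_norm Lnorm1.
  by under eq_integral do rewrite /= normr_id.
have [a [w [N [mN N0 wW fa]]]] :=
  @bochner_integral _ _ R (unit_square_probability R) X W (bg_measurable W) iW.
exists a => f; have [iw ->] := fa f.
have := hW (single_edge f); rewrite single_edge_density.
under eq_fun do rewrite loop_graph_density single_edge_edges big_set1/=.
rewrite /Rintegral.
(* Passes from the cube to the square and from [W] to [w], which turns the limit density into
   [f a]. *)
rewrite (@integral_image_off_null _ _ _ _ _ _ (unit_square R) _
  (@measurable_first_two R) (@unit_cube_first_two R) N
  (fun z => (f (W z))%:E) (fun z => (f (w z))%:E))//.
- exact: measurable_int iw.
- by move=> z Nz; rewrite wW.
Qed.
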